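(* Let $n\geq 5$ and let $\pi=(d_1,d_2,\ldots,d_n)$ be a nonincreasing sequence of positive integers that is graphic. Then $\pi$ is potentially $(K_5-C_4)$-graphic if and only if all of the following conditions hold: (1) $d_1\geq 4$; (2) $d_5\geq 2$; (3) if $n\geq 6$, then $\pi\neq((n-2)^2,2^{n-2})$; (4) $\pi\neq(n-k,\,k+i,\,2^i,\,1^{n-i-2})$ for all integers $k$ and $i$ with $k\in\{1,2,\ldots,\lfloor\frac{n-1}{2}\rfloor-1\}$ and $i\in\{3,4,\ldots,n-2k\}$; (5) if $n=6$, then $\pi\neq(4,2^5)$; (6) if $n=7$, then $\pi\neq(4,2^6)$.
   Context: All graphs are finite and simple. A nonincreasing sequence $\pi=(d_1,\ldots,d_n)$ of nonnegative integers is graphic if it is the degree sequence of a simple graph $G$ on $n$ vertices; such a $G$ is called a realization of $\pi$. For a simple graph $H$, a graphic sequence $\pi$ is potentially $H$-graphic if it has a realization $G$ containing $H$ as a (not necessarily induced) subgraph. $K_5-C_4$ denotes the graph on 5 vertices obtained from the complete graph $K_5$ by removing the four edges of a cycle $C_4$ of length 4 (equivalently, two triangles sharing exactly one common vertex). In writing sequences, the symbol $x^y$ stands for $y$ consecutive terms equal to $x$ (so $x^0$ means no terms); for example $((n-2)^2,2^{n-2})$ is the sequence with two terms equal to $n-2$ followed by $n-2$ terms equal to $2$. *)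

(* Defs.v *)
From mathcomp Require Import all_boot.

Set Implicit Arguments.
Unset Strict Implicit.
Unset Printing Implicit Defensive.

Record sgraph (T : finType) := SGraph {
  adj : rel T;
  adj_sym : symmetric adj;
  adj_irrefl : irreflexive adj
}.

Definition degree (T : finType) (G : sgraph T) (v : T) : nat :=
  #|[set w | adj G v w]|.

(* The degree sequence is taken up to reordering of the vertices. *)
Definition realization (T : finType) (G : sgraph T) (s : seq nat) : Prop :=
  perm_eq [seq degree G v | v : T] s.

(* Not necessarily induced: non-edges of H need not be preserved. *)
Definition contains (T S : finType) (G : sgraph T) (H : sgraph S) : Prop :=
  exists f : S -> T,
    injective f /\ (forall x y : S, adj H x y -> adj G (f x) (f y)).

Definition graphic (n : nat) (s : n.-tuple nat) : Prop :=
  exists G : sgraph 'I_n, realization G s.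

Definition potentially (S : finType) (H : sgraph S) (n : nat)
    (s : n.-tuple nat) : Prop :=
  exists G : sgraph 'I_n, realization G s /\ contains G H.

(* The 4-cycle 0 - 1 - 2 - 3 - 0 on the vertices other than 4. *)
Definition C4_adj (x y : 'I_5) : bool :=
  [&& x < 4, y < 4 & (y == x.+1 %% 4 :> nat) || (x == y.+1 %% 4 :> nat)].

Definition K5_minus_C4_adj (x y : 'I_5) : bool := (x != y) && ~~ C4_adj x y.

Fact K5_minus_C4_sym : symmetric K5_minus_C4_adj.
Proof.
by move=> x y; rewrite /K5_minus_C4_adj /C4_adj eq_sym orbC andbCA.
Qed.

Fact K5_minus_C4_irrefl : irreflexive K5_minus_C4_adj.
Proof. by move=> x; rewrite /K5_minus_C4_adj eqxx. Qed.

Definition K5_minus_C4 : sgraph 'I_5 :=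
  SGraph K5_minus_C4_sym K5_minus_C4_irrefl.

(* Main.v *)
Require Import Defs.
From mathcomp Require Import all_boot.
From mathcomp Require Import zify.
From Stdlib Require Import Classical_Prop.

(** Choose a vertex v of maximum degree and, by Havel-Hakimi switches, a
    realization in which every neighbour of v has degree at least that of every
    vertex outside N(v) + v.  A bowtie centred at v is a pair of disjoint edges
    inside N(v).  If N(v) spans no such pair, it spans a triangle, a star with at
    least two leaves, a single edge, or nothing.  In each case one exchanges
    edges along a closed alternating trail to create the missing edge, or finds
    a bowtie at another centre.  When every trail is blocked, the vertices outside
    N(v) with neighbours in N(v) are so densely joined that their degrees would
    exceed those in N(v); this domination leaves only the exceptional graphs,
    whose degree sequences are the excluded ones: a star with at least two
    leaves leads to (3) and (4), a single edge to (5) and (6).  Conversely, in an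
    excluded sequence with two vertices of degree above 2, one triangle of a
    bowtie centred at the first misses the second, and counting the neighbours of
    these two vertices gives a contradiction. *)

(** * Exchanging edges *)

Definition nbhd {T : finType} (G : sgraph T) x : {set T} := [set w | adj G x w].

(** Edges are stored as ordered pairs but compared as unordered ones. *)
Definition joins {T : eqType} (e : T * T) x y :=
  (x == e.1) && (y == e.2) || (x == e.2) && (y == e.1).

Definition ends {T : Type} (R : seq (T * T)) : seq T :=
  flatten [seq [:: e.1; e.2] | e <- R].

Definition edge_uniq {T : eqType} (R : seq (T * T)) :=
  pairwise (fun e f => ~~ joins e f.1 f.2) R.

(** Permutations of explicit lists are checked by counting with an arbitrary predicate, which leaves
    linear arithmetic. *)
Ltac perm_ends :=
  let p := fresh "p" in
  apply/permP => p; rewrite /=;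
  repeat match goal with |- context [nat_of_bool (p ?x)] =>
    generalize (nat_of_bool (p x)); intro end;
  clear; lia.

Ltac clash := exfalso; match goal with
  | H : is_true (~~ ?b), H' : is_true ?b |- _ => by rewrite H' in H
  | H : is_true (~~ adj ?G ?x ?y), H' : is_true (adj ?G ?y ?x) |- _ =>
      by rewrite adj_sym H' in H
  | H : is_true (adj _ ?x ?x) |- _ => by rewrite adj_irrefl in H
  | H : is_true (?x != ?x) |- _ => by rewrite eqxx in H
  end.

(** Vertices are told apart by identifying them: the substitution makes some pair both adjacent and
    non-adjacent, creates a loop, or contradicts a known inequality. *)
Ltac graph_atom := match goal with
  | |- is_true (~~ joins _ _ _) =>
      apply/negP; rewrite /joins /= => /orP[]/andP[/eqP ? /eqP ?]; subst; clash
  | |- is_true (_ != _) => first [assumption | apply/eqP => ?; subst; clash]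
  | |- is_true (~~ (?x == ?y)) => first [assumption | apply/eqP => ?; subst; clash]
  | |- _ => first [assumption | by rewrite adj_sym | done]
  end.

Ltac graph :=
  rewrite ?/ends ?/edge_uniq /= ?inE ?andbT ?orbF;
  repeat match goal with
    | |- is_true (_ && _) => apply/andP; split
    | |- is_true (~~ (_ || _)) => rewrite negb_or
    end;
  graph_atom.

Section Relink.

Set Implicit Arguments.
Unset Strict Implicit.
Unset Printing Implicit Defensive.

Variable T : finType.
Implicit Types (G : sgraph T) (e : T * T) (R S : seq (T * T)).

Lemma joinsC e x y : joins e x y = joins e y x.
Proof. by rewrite /joins orbC ![(x == _) && _]andbC. Qed.

(** Without repeated edges the multiplicity of a pair is 0 or 1, so it can be compared with
    adjacency inside a degree sum. *)
Lemma count_joins R x y :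
  edge_uniq R -> count (fun e => joins e x y) R = has (fun e => joins e x y) R.
Proof.
elim: R => //= e R IH /andP[/allP eR /IH->].
case: (boolP (joins e x y)) => //= exy.
case: (boolP (has _ _)) => //= /hasP[f fR fxy]; have := eR f fR.
move: exy fxy; rewrite /joins.
by case/orP=> /andP[/eqP-> /eqP->] /orP[]/andP[/eqP-> /eqP->]; rewrite !eqxx ?orbT.
Qed.

Lemma degree_sum G x : degree G x = \sum_y adj G x y.
Proof. by rewrite /degree -sum1dep_card big_mkcond; apply: eq_bigr => y _; case: adj. Qed.

Lemma sum_joins R x : all (fun e => e.1 != e.2) R ->
  \sum_y count (fun e => joins e x y) R = count_mem x (ends R).
Proof.
elim: R => /= [|e R IH]; first by rewrite big1.
case/andP=> ne /IH E; rewrite big_split /= E addnA; congr (_ + _).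
rewrite /joins; case: e ne {E IH} => a b /= ab.
rewrite [a == x]eq_sym [b == x]eq_sym.
have sum_pred1 (z : T) : \sum_y (y == z : nat) = 1.
  by rewrite (bigD1 z) //= eqxx big1 // => y /negPf->.
case: (eqVneq x a) => [->|xa] /=.
  rewrite (negPf ab) -(sum_pred1 b) addn0.
  by apply: eq_bigr => y _; rewrite orbF.
case: (eqVneq x b) => [_|xb] /=; first by rewrite sum_pred1.
by rewrite big1.
Qed.

(** Each vertex loses as many edges in [R] as it gains in [S], since it occurs equally often in both
    end lists. This covers the two-edge switch and the longer alternating exchanges alike. *)
Lemma relink G R S :
    all (fun e => adj G e.1 e.2) R ->
    all (fun e => (e.1 != e.2) && ~~ adj G e.1 e.2) S ->
    edge_uniq R -> edge_uniq S -> perm_eq (ends R) (ends S) ->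
  exists G', [/\ degree G' =1 degree G,
    all (fun e => adj G' e.1 e.2) S,
    forall x y, adj G x y -> ~~ has (fun e => joins e x y) R -> adj G' x y &
    forall x, x \notin ends R -> adj G' x =1 adj G x].
Proof.
move=> aR aS uR uS RS.
pose a x y := adj G x y && ~~ has (fun e => joins e x y) R
              || has (fun e => joins e x y) S.
have a_sym : symmetric a.
  move=> x y; rewrite /a adj_sym; congr (_ && ~~ _ || _);
  by apply: eq_has => e; rewrite joinsC.
have in_S x y : has (fun e => joins e x y) S -> x != y /\ ~~ adj G x y.
  case/hasP=> e /(allP aS)/andP[ne na]; rewrite /joins.
  case/orP=> /andP[/eqP-> /eqP->] //.
  by rewrite eq_sym adj_sym.
have in_R x y : has (fun e => joins e x y) R -> adj G x y.
  case/hasP=> e /(allP aR) ae; rewrite /joins.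
  case/orP=> /andP[/eqP-> /eqP->] //.
  by rewrite adj_sym.
have a_irr : irreflexive a.
  move=> x; rewrite /a adj_irrefl /=; apply/negP => /in_S[].
  by rewrite eqxx.
have neR : all (fun e => e.1 != e.2) R.
  by apply: sub_all aR => e; apply: contraTneq => ->; rewrite adj_irrefl.
have neS : all (fun e => e.1 != e.2) S by apply: sub_all aS => e /andP[].
exists (SGraph a_sym a_irr); split.
(* Adding the losses to both sides avoids subtraction: new degree plus losses equals old degree plus
   gains, term by term over [y]. *)
- move=> x; apply/eqP; rewrite -(eqn_add2r (count_mem x (ends R))).
  rewrite {2}(permP RS) -!sum_joins // !degree_sum -!big_split /=; apply/eqP.
  apply: eq_bigr => y _; rewrite !count_joins // /a.
  have := @in_S x y; have := @in_R x y.
  case: (has _ R) => [/(_ isT)->|_] /=; case: (has _ S) => /=.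
  - by case/(_ isT).
  - by [].
  - by case/(_ isT) => _ /negPf->.
  - by rewrite andbT orbF.
- apply/allP => e eS; rewrite /= /a; apply/orP; right; apply/hasP; exists e => //.
  by rewrite /joins !eqxx.
- by move=> x y axy nR; rewrite /= /a axy nR.
move=> x xR y; rewrite /= /a.
have not_end Q : x \notin ends Q -> has (fun e => joins e x y) Q = false.
  move=> xQ; apply/negP => /hasP[e eQ exy]; case/negP: xQ.
  apply/flattenP; exists [:: e.1; e.2]; first exact: map_f.
  by rewrite !inE; case/orP: exy => /andP[/eqP-> _]; rewrite eqxx ?orbT.
by rewrite !not_end -?(perm_mem RS) // andbT orbF.
Qed.

End Relink.

Ltac relinking G R S H dH new keep fx :=
  destruct (@relink _ G R S ltac:(by graph) ltac:(by graph) ltac:(by graph)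
    ltac:(by graph) ltac:(by perm_ends)) as [H [dH new keep fx]];
  simpl in new.

Section Bowtie.

Set Implicit Arguments.
Unset Strict Implicit.
Unset Printing Implicit Defensive.

Variable T : finType.
Implicit Type G : sgraph T.

(** * Bowties around a dominant neighbourhood *)

Lemma degree_nbhd G x : degree G x = #|nbhd G x|.
Proof. by []. Qed.

Lemma degree_ge G x (s : seq T) :
  uniq s -> all (adj G x) s -> size s <= degree G x.
Proof.
move=> us /allP as_; rewrite -(card_uniqP us); apply/subset_leq_card/subsetP.
by move=> y /as_; rewrite inE.
Qed.

Lemma bowtie_contains G v a b c d :
    adj G v a -> adj G v b -> adj G v c -> adj G v d ->
    adj G a b -> adj G c d -> uniq [:: a; b; c; d] ->
  contains G K5_minus_C4.
Proof.
(* With the cycle 0-1-2-3 removed, the edges left are 0-2, 1-3 and all pairs with 4; hence the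
   interleaved order with the centre last. *)
move=> va vb vc vd ab cd us; pose s := [:: a; c; b; d; v].
have uvs : uniq s.
  rewrite (perm_uniq (_ : perm_eq s (v :: [:: a; b; c; d]))); last first.
    by perm_ends.
  rewrite cons_uniq us andbT !inE !negb_or.
  by apply/and4P; split; apply: contraTneq isT => E; subst;
     rewrite adj_irrefl in va vb vc vd *.
exists (fun i : 'I_5 => nth v s i); split.
  by move=> i j /eqP; rewrite nth_uniq // => /eqP/val_inj.
move=> [[|[|[|[|[|//]]]]] ?] [[|[|[|[|[|//]]]]] ?] //= _;
by rewrite // adj_sym.
Qed.

Lemma card_extra (W : {set T}) (s : seq T) :
  size s < #|W| -> exists2 u, u \in W & u \notin s.
Proof.
move=> sW; apply/exists_inP; apply: contraTT sW; rewrite negb_exists -leqNgt => /forallP Ws.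
apply: leq_trans (card_size s); apply/subset_leq_card/subsetP => x xW.
by have := Ws x; rewrite xW negbK.
Qed.

Lemma degree2_nbrs G x a b z :
  adj G x a -> adj G x b -> a != b -> degree G x <= 2 -> adj G x z ->
  z = a \/ z = b.
Proof.
move=> xa xb ab dx xz; case: (eqVneq z a) => [|za]; first by left.
case: (eqVneq z b) => [|zb]; first by right.
have := @degree_ge G x [:: a; b; z]; rewrite /= xa xb xz !inE negb_or ab.
rewrite ![_ == z]eq_sym za zb => /(_ isT isT).
by move/leq_trans/(_ dx).
Qed.

Lemma second_nbr G x y : 2 <= degree G x -> exists2 z, adj G x z & z != y.
Proof.
by case/(@card_extra _ [:: y]) => z; rewrite !inE => ? ?; exists z.
Qed.

(** The sequences of conditions (3) to (6), up to permutation because the degrees of a graph are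
    listed unsorted. *)
Definition exceptional (n : nat) (s : seq nat) : Prop :=
  [\/ 6 <= n /\ perm_eq s (nseq 2 (n - 2) ++ nseq (n - 2) 2),
      exists k i, [/\ 1 <= k <= (n - 1) %/ 2 - 1, 3 <= i <= n - 2 * k &
        perm_eq s ([:: n - k; k + i] ++ nseq i 2 ++ nseq (n - i - 2) 1)],
      n = 6 /\ perm_eq s (4 :: nseq 5 2) |
      n = 7 /\ perm_eq s (4 :: nseq 6 2)].

(** Allowing any graph with the same degrees makes this dichotomy invariant under edge exchanges. *)
Definition settled G : Prop :=
  (exists G', degree G' =1 degree G /\ contains G' K5_minus_C4)
  \/ exceptional #|T| [seq degree G x | x : T].

Lemma settled_eq G G' : degree G' =1 degree G -> settled G' -> settled G.
Proof.
move=> dG; rewrite /settled /image_mem (eq_map dG) => -[[H [dH cH]]|]; last by right.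
by left; exists H; split=> // x; rewrite dH dG.
Qed.

Lemma bowtie_settled G v a b c d :
    adj G v a -> adj G v b -> adj G v c -> adj G v d ->
    adj G a b -> adj G c d -> uniq [:: a; b; c; d] ->
  settled G.
Proof. by move=> *; left; exists G; split=> //; apply: (@bowtie_contains _ v a b c d). Qed.

(* The neighbourhood of the apex is dominant: what a Havel-Hakimi switch achieves. *)
Record apex G v : Prop := Apex {
  apex_pos : forall x, 0 < degree G x;
  apex_max : forall x, degree G x <= degree G v;
  apex_dom : forall u m, adj G v u -> ~~ adj G v m -> m != v ->
    degree G m <= degree G u;
  apex_rich : 4 <= #|[set u | adj G v u & 2 <= degree G u]|
}.

Lemma apex_eq G G' v :
  degree G' =1 degree G -> adj G' v =1 adj G v -> apex G v -> apex G' v.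
Proof.
move=> dG aG [p M d r]; split.
- by move=> x; rewrite dG.
- by move=> x; rewrite !dG.
- by move=> u m; rewrite !dG !aG; apply: d.
rewrite (_ : [set u | _ & _] = [set u | adj G v u & 2 <= degree G u]) //.
by apply/setP => u; rewrite !inE dG aG.
Qed.

(** * Triangles in the neighbourhood *)

Lemma triangle_settled G v a b c :
    apex G v -> adj G v a -> adj G v b -> adj G v c ->
    adj G a b -> adj G b c -> adj G a c ->
  settled G.
Proof.
move=> aG va vb vc ab bc ac.
have [u] := @card_extra _ [:: a; b; c] (apex_rich aG).
rewrite !inE !negb_or => /andP[vu du] /and3P[ua ub uc].
have [w uw wv] := @second_nbr G u v du.
have ba : adj G b a by rewrite adj_sym.
have ca : adj G c a by rewrite adj_sym.
have cb : adj G c b by rewrite adj_sym.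
have wc : settled G \/ w != c.
  case: (eqVneq w c) => [E|]; [subst w; left | by right].
  by apply: (@bowtie_settled G v u c a b) => //; graph.
have wa : settled G \/ w != a.
  case: (eqVneq w a) => [E|]; [subst w; left | by right].
  by apply: (@bowtie_settled G v u a b c) => //; graph.
have wb : settled G \/ w != b.
  case: (eqVneq w b) => [E|]; [subst w; left | by right].
  by apply: (@bowtie_settled G v u b a c) => //; graph.
case: wa wb wc => // wa [|wb] // [|wc] //.
case: (boolP (adj G v w)) => [vw|nvw].
  by apply: (@bowtie_settled G v u w a b) => //; graph.
case: (boolP (adj G u a)) => [ua'|nua].
  by apply: (@bowtie_settled G v u a b c) => //; graph.
case: (boolP (adj G u b)) => [ub'|nub].
  by apply: (@bowtie_settled G v u b a c) => //; graph.
(* If [w] misses [a], trading [a b], [u w] for [a w], [b u] puts the disjoint edges [b u] and [a c]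
   into N(v); likewise below with [a] and [b] swapped. *)
case: (boolP (adj G w a)) => aw; last first.
  relinking G [:: (a, b); (u, w)] [:: (a, w); (b, u)] H dH new keep fx.
  case/and3P: new => _ bu _; apply: (settled_eq dH).
  have vH : adj H v =1 adj G v by apply: fx; graph.
  by apply: (@bowtie_settled H v b u a c) => //; rewrite ?vH ?keep //; graph.
case: (boolP (adj G w b)) => bw; last first.
  relinking G [:: (b, a); (u, w)] [:: (b, w); (a, u)] H dH new keep fx.
  case/and3P: new => _ au _; apply: (settled_eq dH).
  have vH : adj H v =1 adj G v by apply: fx; graph.
  by apply: (@bowtie_settled H v a u b c) => //; rewrite ?vH ?keep //; graph.
(* Now [w] sees both [a] and [b], and the bowtie is centred at [a], with triangles [a b w] and
   [a c v]. *)
by apply: (@bowtie_settled G a b w c v) => //; graph.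
Qed.

(** * Stars with at least two leaves in the neighbourhood *)

Lemma cherry_edge G v c l1 l2 w w' :
    apex G v -> adj G v c -> adj G v l1 -> adj G v l2 -> l1 != l2 ->
    adj G c l1 -> adj G c l2 ->
    adj G v w -> adj G v w' -> w != c -> w' != c -> adj G w w' ->
  settled G.
Proof.
move=> aG vc vl1 vl2 l12 cl1 cl2 vw vw' wc w'c ww'.
(* A leaf off [w w'] gives an edge disjoint from it; if both leaves lie on [w w'], they form a
   triangle with [c]. *)
case: (boolP (l1 \in [:: w; w'])) => h1; last first.
  move: h1; rewrite !inE negb_or => /andP[h1 h1'].
  by apply: (@bowtie_settled G v c l1 w w') => //; graph.
case: (boolP (l2 \in [:: w; w'])) => h2; last first.
  move: h2; rewrite !inE negb_or => /andP[h2 h2'].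
  by apply: (@bowtie_settled G v c l2 w w') => //; graph.
apply: (@triangle_settled G v c l1 l2) => //.
move: h1 h2; rewrite !inE => /orP[]/eqP ? /orP[]/eqP ?; subst => //; try clash.
by rewrite adj_sym.
Qed.
Lemma map_const_in (f : T -> nat) x (s : seq T) :
  {in s, forall y, f y = x} -> map f s = nseq (size s) x.
Proof.
move=> fs; rewrite -(size_map f s); apply/all_pred1P.
by rewrite all_map; apply/allP => y /fs /= ->.
Qed.

Lemma enum_perm (s : seq T) : uniq s -> (forall x, x \in s) -> perm_eq (enum T) s.
Proof.
by move=> us fs; apply: uniq_perm (enum_uniq _) us _ => x; rewrite mem_enum inE fs.
Qed.

(** If the graph is not settled, every edge inside N(v) meets [c]. Neighbours of [v] split into
    leaves, adjacent to [c], and non-leaves. Leaves turn out to have degree 2, and whether some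
    non-leaf has degree at least 2 decides between the excluded forms (3) and (4). *)
Lemma cherry_settled G v c l1 l2 :
    apex G v -> adj G v c -> adj G v l1 -> adj G v l2 -> l1 != l2 ->
    adj G c l1 -> adj G c l2 ->
  settled G.
Proof.
move=> aG vc vl1 vl2 l12 cl1 cl2; apply: NNPP => nS.
have cv : adj G c v by rewrite adj_sym.
have nW w w' : adj G v w -> adj G v w' -> w != c -> w' != c -> ~~ adj G w w'.
  move=> vw vw' wc w'c; apply/negP => ww'; case: nS.
  exact: (@cherry_edge G v c l1 l2 w w').
have leaf l : exists l', [/\ adj G v l', adj G c l' & l' != l].
  case: (eqVneq l1 l) => [<-|]; last by exists l1.
  by exists l2; split=> //; rewrite eq_sym.
(* Otherwise c is the centre of a bowtie with triangles c l m and c l' v. *)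
have apart l m : adj G v l -> adj G c l -> ~~ adj G v m -> m != v ->
    adj G l m -> ~~ adj G c m.
  move=> vl cl nvm mv lm; apply/negP => cm; case: nS.
  have [l' [vl' cl' l'l]] := leaf l.
  by apply: (@bowtie_settled G c l m l' v) => //; graph.
(* Otherwise a switch adds [w1 w2], an edge of N(v) avoiding [c], and keeps the star. *)
have clique w1 w2 m1 m2 : adj G v w1 -> adj G v w2 -> w1 != c -> w2 != c ->
    w1 != w2 -> ~~ adj G v m1 -> ~~ adj G v m2 -> m1 != v -> m2 != v ->
    m1 != m2 -> adj G w1 m1 -> adj G w2 m2 -> adj G m1 m2.
  move=> vw1 vw2 w1c w2c w12 nvm1 nvm2 m1v m2v m12 wm1 wm2.
  apply/negPn/negP => nm12; case: nS; have nw12 := nW _ _ vw1 vw2 w1c w2c.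
  relinking G [:: (w1, m1); (w2, m2)] [:: (w1, w2); (m1, m2)] H dH new keep fx.
  case/and3P: new => w12' _ _; apply: (settled_eq dH).
  have vH : adj H v =1 adj G v by apply: fx; graph.
  by apply: (@cherry_edge H v c l1 l2 w1 w2) => //;
    [exact: apex_eq aG | rewrite ?vH ?keep //; graph ..].
(* Otherwise trading [c l], [w m] for [c m], [l w] leaves [l w] disjoint from [c l']. *)
have tie w l l' m : adj G v w -> w != c -> adj G v l -> adj G c l ->
    adj G v l' -> adj G c l' -> l != w -> l' != w -> l != l' ->
    ~~ adj G v m -> m != v -> adj G w m -> adj G c m.
  move=> vw wc vl cl vl' cl' lw l'w ll' nvm mv wm.
  apply/negPn/negP => ncm; case: nS.
  have nlw : ~~ adj G l w by apply: nW => //; graph.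
  relinking G [:: (c, l); (w, m)] [:: (c, m); (l, w)] H dH new keep fx.
  case/and3P: new => _ lw' _; apply: (settled_eq dH).
  have vH : adj H v =1 adj G v by apply: fx; graph.
  by apply: (@bowtie_settled H v c l' l w) => //; rewrite ?vH ?keep //; graph.
have tieU u m : adj G v u -> u != c -> ~~ adj G c u ->
    ~~ adj G v m -> m != v -> adj G u m -> adj G c m.
  by move=> vu uc ncu nvm mv um; apply: (tie u l1 l2 m) => //; graph.
(* Otherwise a three-edge exchange adds [l1 u], disjoint from [c l2]. *)
have cliqueU u m z : adj G v u -> u != c -> ~~ adj G c u ->
    ~~ adj G v m -> ~~ adj G v z -> m != v -> z != v -> m != z ->
    adj G u m -> adj G u z -> adj G m z.
  move=> vu uc ncu nvm nvz mv zv mz um uz; apply/negPn/negP => nmz; case: nS.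
  have nlu : ~~ adj G l1 u by apply: nW => //; graph.
  relinking G [:: (c, l1); (u, m); (u, z)] [:: (l1, u); (m, z); (u, c)] H dH new keep fx.
  case/and4P: new => l1u _ _ _; apply: (settled_eq dH).
  have vH : adj H v =1 adj G v by apply: fx; graph.
  by apply: (@bowtie_settled H v c l2 l1 u) => //; rewrite ?vH ?keep //; graph.
have farU u : adj G v u -> u != c -> ~~ adj G c u -> 2 <= degree G u ->
    exists m, [/\ ~~ adj G v m, m != v & adj G u m].
  move=> vu uc ncu du; have [m um mv] := @second_nbr G u v du.
  exists m; split=> //; apply/negP => vm; have [E|mc] := eqVneq m c.
    by subst; clash.
  by have := nW u m vu vm uc mc; rewrite um.
(* Suppose [l m] is an edge. A non-leaf [u] of degree at least 2 would have an outside neighbour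
   [m1] of degree larger than its own, against domination. Without such [u] there are two further
   leaves, and [tie] forces the forbidden edge [c m]. *)
have NL l m : adj G v l -> adj G c l -> ~~ adj G v m -> m != v -> ~~ adj G l m.
  move=> vl cl nvm mv; apply/negP => lm; have lc : l != c by graph.
  have ncm := apart l m vl cl nvm mv lm.
  case: (boolP [exists u, [&& adj G v u, u != c, ~~ adj G c u & 2 <= degree G u]]).
    case/existsP => u /and4P[vu uc ncu du].
    have [m1 [nvm1 m1v um1]] := farU u vu uc ncu du.
    have cm1 := tieU u m1 vu uc ncu nvm1 m1v um1.
    have num : ~~ adj G u m.
      by apply/negP => um; have := tieU u m vu uc ncu nvm mv um; rewrite (negPf ncm).
    have m1m : adj G m1 m by apply: (clique u l m1 m) => //; graph.
    pose Z := nbhd G u :\ v :\ m1.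
    have : #|u |: (c |: (m |: Z))| <= degree G m1.
      apply/subset_leq_card/subsetP => z; rewrite !inE.
      case/or4P=> [/eqP->|/eqP->|/eqP->|/and3P[zm1 zv uz]] //; try by rewrite adj_sym.
      case: (boolP (adj G v z)) => [vz|nvz]; last by apply: (cliqueU u m1 z) => //; graph.
      have zc : z != c by graph.
      by have := nW u z vu vz uc zc; rewrite uz.
    have uZ : u \notin c |: (m |: Z) by rewrite !inE adj_irrefl !andbF orbF negb_or; graph.
    have cZ : c \notin m |: Z.
      by rewrite !inE [adj G u c]adj_sym (negPf ncu) !andbF orbF; graph.
    have mZ : m \notin Z by rewrite !inE (negPf num) !andbF.
    rewrite !cardsU1 uZ cZ mZ.
    have := apex_dom aG vu nvm1 m1v; rewrite [degree G u]degree_nbhd (cardsD1 v (nbhd G u)).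
    rewrite (cardsD1 m1 (nbhd G u :\ v)) -/Z !inE [adj G u v]adj_sym vu m1v um1.
    by clear; lia.
  rewrite negb_exists => /forallP noU.
  have : 2 < #|[set x | adj G v x & adj G c x]|.
    have sub : [set u | adj G v u & 2 <= degree G u] \subset
           c |: [set x | adj G v x & adj G c x].
      apply/subsetP => u; rewrite !inE => /andP[vu du].
      by have := noU u; rewrite vu du andbT /= negb_and !negbK.
    have := leq_trans (apex_rich aG) (subset_leq_card sub).
    by rewrite cardsU1; case: (c \notin _) => //= /ltnW.
  move=> L3; have [l3] := @card_extra _ [:: l] (ltnW L3).
  rewrite !inE => /andP[vl3 cl3] l3l.
  have [l4] := @card_extra _ [:: l; l3] L3.
  rewrite !inE negb_or => /andP[vl4 cl4] /andP[l4l l43].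
  by case/negP: ncm; apply: (tie l l3 l4 m) => //; graph.
have degL l : adj G v l -> adj G c l -> degree G l <= 2.
  move=> vl cl; apply: leq_trans (subset_leq_card _) (_ : #|[set v; c]| <= 2); last first.
    by rewrite cards2; case: (_ != _).
  apply/subsetP => z; rewrite !inE => lz; have [//|zv] := eqVneq z v.
  have [//|zc] := eqVneq z c; have lc : l != c by graph.
  case: (boolP (adj G v z)) => [vz|nvz]; last by rewrite (negPf (NL l z vl cl nvz zv)) in lz.
  by rewrite (negPf (nW l z vl vz lc zc)) in lz.
have degM m : ~~ adj G v m -> m != v -> degree G m <= 2.
  by move=> nvm mv; apply: leq_trans (apex_dom aG vl1 nvm mv) (degL l1 vl1 cl1).
pose L := [set l | adj G v l & adj G c l].
pose U := [set u | [&& adj G v u, u != c & ~~ adj G c u]].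
have nbv : nbhd G v = c |: (L :|: U).
  apply/setP => z; rewrite !inE.
  have [->|zc] := eqVneq z c; first by rewrite vc.
  by case: (adj G v z); case: (adj G c z).
have dL l : l \in L -> degree G l = 2.
  rewrite inE => /andP[vl cl]; apply/eqP; rewrite eqn_leq degL //=.
  by apply: (@degree_ge G l [:: v; c]); rewrite /= ?inE; graph.
have cv' : c \notin L :|: U by rewrite !inE adj_irrefl eqxx !andbF.
have LU : [disjoint L & U].
  by rewrite disjoints_subset; apply/subsetP => z; rewrite !inE => /andP[-> ->]; rewrite andbF.
have dv : degree G v = #|L| + #|U| + 1.
  by rewrite degree_nbhd nbv cardsU1 cv' cardsU disjoint_setI0 // cards0 subn0 addnC.
have l1L : l1 \in L by rewrite inE vl1.
have l2L : l2 \in L by rewrite inE vl2.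
have L2 : 2 <= #|L|.
  have : [set l1; l2] \subset L by rewrite subUset !sub1set l1L.
  by move/subset_leq_card; rewrite cards2 l12.
(* In this case [u] is the only non-leaf and [m] the only vertex outside N(v) + v, which gives the
   sequence of (3). *)
case: (boolP [exists u, (u \in U) && (2 <= degree G u)]).
  case/existsP=> u /andP[]; rewrite inE => /and3P[vu uc ncu] du.
  have [m [nvm mv um]] := farU u vu uc ncu du.
  have cm := tieU u m vu uc ncu nvm mv um.
  have mu : adj G m u by rewrite adj_sym.
  have mc : adj G m c by rewrite adj_sym.
  have nbm z : adj G m z -> z = u \/ z = c by apply: degree2_nbrs => //; exact: degM.
  have dm : degree G m = 2.
    apply/eqP; rewrite eqn_leq degM //=.
    by apply: (@degree_ge G m [:: u; c]); rewrite /= ?inE; graph.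
  have nbu z : adj G u z -> z = v \/ z = m.
    move=> uz; have [|zv] := eqVneq z v; first by left.
    have [|zm] := eqVneq z m; first by right.
    have zc : z != c by graph.
    case: (boolP (adj G v z)) => [vz|nvz]; first by rewrite (negPf (nW u z vu vz uc zc)) in uz.
    have zm' : adj G m z by apply: (cliqueU u m z) => //; graph.
    by case: (nbm z zm') => E; subst; clash.
  have Uu : U = [set u].
    apply/eqP; rewrite eqEsubset sub1set !inE vu uc ncu !andbT; apply/subsetP => w.
    rewrite !inE => /and3P[vw wc ncw]; apply/negPn/negP => wu.
    have dw : 2 <= degree G w by rewrite -dm; apply: (apex_dom aG).
    have [z [nvz zv wz]] := farU w vw wc ncw dw.
    have [E|zm] := eqVneq z m.
      by subst z; have [|E|E] := nbm w; [graph | subst; clash ..].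
    have mz : adj G m z by apply: (clique u w m z) => //; graph.
    by case: (nbm z mz) => E; subst; clash.
  (* A second outside neighbour would give [c] degree at least |L| + 3, while the maximum is |L| +
     2. *)
  have cM z : ~~ adj G v z -> z != v -> z != m -> ~~ adj G c z.
    move=> nvz zv zm; apply/negP => cz.
    have : #|v |: (m |: (z |: L))| <= degree G c.
      apply/subset_leq_card/subsetP => y; rewrite !inE.
      by case/or4P=> [/eqP->|/eqP->|/eqP->|/andP[]].
    rewrite !cardsU1 !inE !negb_or (negPf nvz) (negPf nvm) adj_irrefl eq_sym mv eq_sym zv.
    rewrite eq_sym zm /= => /leq_trans/(_ (apex_max aG c)).
    by rewrite dv Uu cards1; clear; lia.
  have only_m y : ~~ adj G v y -> y != v -> y = m.
    move=> nvy yv; apply/eqP/negPn/negP => ym.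
    have [z yz] : exists z, adj G y z.
      by have [z] := @card_extra (nbhd G y) [::] (apex_pos aG y); rewrite inE; exists z.
    have ncy := cM y nvy yv ym.
    have nvz : ~~ adj G v z.
      apply/negP => vz; have zc : z != c by graph.
      case: (boolP (adj G c z)) => cz; first by have := NL z y vz cz nvy yv; rewrite adj_sym yz.
      have : z \in U by rewrite inE vz zc.
      rewrite Uu inE => /eqP E; subst z.
      by have [|E|E] := nbu y; [graph | subst; clash ..].
    have zv : z != v by graph.
    have zm : z != m.
      apply/eqP => E; subst z.
      by have [|E|E] := nbm y; [graph | subst; clash ..].
    have ncz := cM z nvz zv zm.
    have nmy : ~~ adj G m y by apply/negP => my; case: (nbm y my) => E; subst; clash.
    have nl1u : ~~ adj G l1 u by apply: nW => //; graph.
    (* The stray edge [y z] closes the trail: [l1 u] appears, disjoint from [c l2]. *)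
    case: nS; relinking G [:: (c, l1); (u, m); (y, z)]
      [:: (l1, u); (m, y); (c, z)] H dH new keep fx.
    case/and4P: new => l1u _ _ _; apply: (settled_eq dH).
    have vH : adj H v =1 adj G v by apply: fx; graph.
    by apply: (@bowtie_settled H v c l2 l1 u) => //; rewrite ?vH ?keep //; graph.
  have dc : degree G c = #|L| + 2.
    have -> : degree G c = #|v |: (m |: L)|.
      rewrite degree_nbhd; congr #|pred_of_set _|; apply/setP => z; rewrite !inE.
      have [->|zv] := eqVneq z v; first by rewrite cv.
      have [->|zm] := eqVneq z m; first by rewrite cm.
      by case: (boolP (adj G v z)) => //= nvz; case/eqP: zm; exact: only_m.
    by rewrite !cardsU1 !inE negb_or eq_sym mv adj_irrefl (negPf nvm) addnA addnC.
  have du2 : degree G u = 2.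
    apply/eqP; rewrite eqn_leq du andbT.
    have: nbhd G u \subset [set v; m].
      by apply/subsetP => z; rewrite !inE => /nbu[]->; rewrite eqxx ?orbT.
    move/subset_leq_card/leq_trans; apply; rewrite cards2; by case: (_ != _).
  have enumT : perm_eq (enum T) ([:: v; c; u; m] ++ enum L).
    apply: enum_perm.
      rewrite cat_uniq enum_uniq andbT; apply/andP; split; first by graph.
      apply/hasPn => y; rewrite mem_enum inE => /andP[vy cy].
      by rewrite !inE !negb_or; graph.
    move=> y; rewrite mem_cat mem_enum !inE.
    have [//|yv] := eqVneq y v; have [//|yc] := eqVneq y c.
    case: (boolP (adj G v y)) => vy; last by rewrite (only_m y vy yv) eqxx orbT.
    case: (boolP (adj G c y)) => cy; first by rewrite orbT.
    have : y \in U by rewrite inE vy yc.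
    by rewrite Uu inE => ->.
  have cardT : #|T| = #|L|.+4 by rewrite cardT (perm_size enumT) size_cat -cardE.
  case: nS; right; constructor 1; rewrite cardT !subSS subn0; split; first by clear -L2; lia.
  apply: (perm_trans (perm_map _ enumT)); rewrite map_cat (@map_const_in _ 2 (enum L)); last first.
    by move=> y; rewrite mem_enum => /dL.
  by rewrite -cardE /= dv dc du2 dm Uu cards1 addn2 -addnA addn2.
rewrite negb_exists => /forallP noU.
have dU u : u \in U -> degree G u <= 1.
  by move=> uU; have := noU u; rewrite uU /= -leqNgt.
have L3 : 2 < #|L|.
  have sub : [set u | adj G v u & 2 <= degree G u] \subset c |: L.
    apply/subsetP => u; rewrite !inE => /andP[vu du].
    have [//|uc] := eqVneq u c; case: (boolP (adj G c u)) => cu; rewrite vu //=.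
    by have := noU u; rewrite inE vu uc cu du.
  have := leq_trans (apex_rich aG) (subset_leq_card sub).
  by rewrite cardsU1; case: (c \notin _) => //= /ltnW.
(* If there are no non-leaves, [c] would exceed the maximum degree. Otherwise a non-leaf, of degree
   at most 1, dominates [y], which has the two neighbours [c] and [z]. *)
have ncM y z : ~~ adj G v y -> y != v -> ~~ adj G v z -> adj G y z -> ~~ adj G c y.
  move=> nvy yv nvz yz; apply/negP => cy.
  have [U0|[u uU]] := set_0Vmem U.
    have : #|v |: (y |: L)| <= degree G c.
      apply/subset_leq_card/subsetP => x; rewrite !inE.
      by case/or3P=> [/eqP->|/eqP->|/andP[]].
    rewrite !cardsU1 !inE !negb_or (negPf nvy) adj_irrefl eq_sym yv.
    move=> /= /leq_trans/(_ (apex_max aG c)).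
    by rewrite dv U0 cards0; clear; lia.
  have := dU u uU; move: uU; rewrite inE => /and3P[vu _ _] du.
  have := leq_trans (apex_dom aG vu nvy yv) du; apply/negP; rewrite -ltnNge.
  by apply: (@degree_ge G y [:: c; z]); rewrite /= ?inE; graph.
have noM y z : ~~ adj G v y -> y != v -> ~~ adj G v z -> z != v -> ~~ adj G y z.
  move=> nvy yv nvz zv; apply/negP => yz; case: nS.
  have ncy := ncM y z nvy yv nvz yz.
  have ncz : ~~ adj G c z by apply: (ncM z y) => //; graph.
  have [l3] := @card_extra _ [:: l1; l2] L3.
  rewrite !inE negb_or => /andP[vl3 cl3] /andP[l31 l32].
  have nl12 : ~~ adj G l1 l2 by apply: nW => //; graph.
  (* A third leaf is essential: the exchange spends [c l1] and [c l2] to create [l1 l2], and [l3]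
     keeps the triangle [v c l3]. *)
  relinking G [:: (c, l1); (c, l2); (y, z)] [:: (l1, l2); (c, y); (c, z)] H dH new keep fx.
  case/and4P: new => l12' _ _ _; apply: (settled_eq dH).
  have vH : adj H v =1 adj G v by apply: fx; graph.
  by apply: (@bowtie_settled H v c l3 l1 l2) => //; rewrite ?vH ?keep //; graph.
pose M := [set m | (m != v) && ~~ adj G v m].
have nbM m : m \in M -> nbhd G m = [set c].
  rewrite inE => /andP[mv nvm].
  have sub z : adj G m z -> z = c.
    move=> mz; have zv : z != v by graph.
    case: (boolP (adj G v z)) => vz; last by rewrite (negPf (noM m z nvm mv vz zv)) in mz.
    apply/eqP/negPn/negP => zc.
    case: (boolP (adj G c z)) => cz; first by have := NL z m vz cz nvm mv; rewrite adj_sym mz.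
    have := dU z; rewrite inE vz zc cz => /(_ isT); apply/negP; rewrite -ltnNge.
    by apply: (@degree_ge G z [:: v; m]); rewrite /= ?inE; graph.
  have [z] := @card_extra (nbhd G m) [::] (apex_pos aG m); rewrite inE => mz _.
  have E := sub z mz; subst z; apply/setP => z; rewrite !inE.
  by apply/idP/eqP => [/sub | ->].
have dM m : m \in M -> degree G m = 1 by move=> mM; rewrite degree_nbhd nbM ?cards1.
have nbc : nbhd G c = v |: (L :|: M).
  apply/setP => z; rewrite !inE; have [->|zv] := eqVneq z v; first by rewrite cv.
  case: (boolP (adj G v z)) => //= nvz; first by rewrite orbF.
  have := nbM z; rewrite inE zv nvz => /(_ isT)/setP/(_ c).
  by rewrite !inE eqxx adj_sym.
have LM : [disjoint L & M].
  rewrite disjoints_subset; apply/subsetP => z; rewrite !inE => /andP[-> _].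
  by rewrite andbF.
have dc : degree G c = #|L| + #|M| + 1.
  rewrite degree_nbhd nbc cardsU1 !inE eqxx adj_irrefl cardsU disjoint_setI0 //.
  by rewrite cards0 subn0 addnC.
have dU1 u : u \in U -> degree G u = 1.
  by move=> uU; apply/eqP; rewrite eqn_leq dU // (apex_pos aG).
have enumT : perm_eq (enum T) ([:: v; c] ++ enum L ++ enum U ++ enum M).
  apply: enum_perm.
    rewrite !cat_uniq !enum_uniq !andTb andbT; apply/and4P; split.
    - by graph.
    - apply/hasPn => y; rewrite !mem_cat !mem_enum !inE negb_or.
      by case/or3P=> /andP[vy cy]; apply/andP; split; try case/andP: cy => *; graph.
    - apply/hasPn => y; rewrite !mem_cat !mem_enum !inE.
      by case/orP=> [/and3P[-> _ ->] | /andP[_ /negPf->]] //; rewrite andbF.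
    - apply/hasPn => y; rewrite !mem_enum !inE => /andP[_ /negPf->] //.
  move=> y; rewrite !mem_cat !mem_enum !inE.
  have [//|yv] := eqVneq y v; have [//|yc] := eqVneq y c.
  by case: (adj G v y); case: (adj G c y).
have cardT : #|T| = #|L| + #|U| + #|M| + 2.
  by rewrite cardT (perm_size enumT) !size_cat -!cardE /=; clear; lia.
have dcv : #|M| <= #|U|.
  by have := apex_max aG c; rewrite dc dv; clear; lia.
(* With this [k], n - k is the degree of [v] and k + i that of [c]; the bound i <= n - 2k amounts to
   |M| <= |U|, the maximality of [v]. *)
case: nS; right; constructor 2; exists #|M|.+1, #|L|; split.
- by rewrite cardT; clear -dcv L3; lia.
- by rewrite cardT; clear -dcv L3; lia.
apply: (perm_trans (perm_map _ enumT)); rewrite !map_cat.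
rewrite (@map_const_in _ 2 (enum L)); last by move=> y; rewrite mem_enum => /dL.
rewrite (@map_const_in _ 1 (enum U)); last by move=> y; rewrite mem_enum => /dU1.
rewrite (@map_const_in _ 1 (enum M)); last by move=> y; rewrite mem_enum => /dM.
rewrite -!cardE -nseqD /= dv dc.
have -> : #|T| - #|M|.+1 = #|L| + #|U| + 1 by rewrite cardT; clear; lia.
have -> : #|T| - #|L| - 2 = #|U| + #|M| by rewrite cardT; clear; lia.
by have -> : #|M|.+1 + #|L| = #|L| + #|M| + 1 by clear; lia.
Qed.

(** * A single edge in the neighbourhood *)

Lemma two_edges_settled G v c l u w :
    apex G v -> adj G v c -> adj G v l -> adj G c l ->
    adj G v u -> adj G v w -> adj G u w -> u != c -> u != l ->
  settled G.
Proof.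
move=> aG vc vl cl vu vw uw uc ul.
have [E|wc] := eqVneq w c.
  by subst w; apply: (@cherry_settled G v c l u) => //; graph.
have [E|wl] := eqVneq w l.
  by subst w; apply: (@cherry_settled G v l c u) => //; graph.
by apply: (@bowtie_settled G v c l u w) => //; graph.
Qed.

(** With [c l] the only edge in N(v), two further neighbours [u], [u'] of degree at least 2 have
    mutually adjacent outside neighbours, whose degrees domination bounds. What survives is one
    common outside neighbour (order 6) or two adjacent ones (order 7). *)
Lemma edge_settled G v c l :
    apex G v -> adj G v c -> adj G v l -> adj G c l -> settled G.
Proof.
move=> aG vc vl cl; apply: NNPP => nS.
have cv : adj G c v by rewrite adj_sym.
have lv : adj G l v by rewrite adj_sym.
have lc : adj G l c by rewrite adj_sym.
have nN u w : adj G v u -> adj G v w -> u != c -> u != l -> ~~ adj G u w.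
  move=> vu vw uc ul; apply/negP => uw; case: nS.
  exact: (@two_edges_settled G v c l u w).
have clique w1 w2 m1 m2 : adj G v w1 -> adj G v w2 -> w1 != c -> w1 != l ->
    w1 != w2 -> ~~ adj G v m1 -> ~~ adj G v m2 -> m1 != v -> m2 != v ->
    m1 != m2 -> adj G w1 m1 -> adj G w2 m2 -> adj G m1 m2.
  move=> vw1 vw2 w1c w1l w12 nvm1 nvm2 m1v m2v m12 wm1 wm2.
  apply/negPn/negP => nm12; case: nS; have nw12 := nN _ _ vw1 vw2 w1c w1l.
  relinking G [:: (w1, m1); (w2, m2)] [:: (w1, w2); (m1, m2)] H dH new keep fx.
  case/and3P: new => w12' _ _; apply: (settled_eq dH).
  have vH : adj H v =1 adj G v by apply: fx; graph.
  by apply: (@two_edges_settled H v c l w1 w2) => //;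
    [exact: apex_eq aG | rewrite ?vH ?keep //; graph ..].
(* Otherwise [c l] is spent to join [u] to both [c] and [l], a star with two leaves. *)
have cliqueU u m z : adj G v u -> u != c -> u != l ->
    ~~ adj G v m -> ~~ adj G v z -> m != v -> z != v -> m != z ->
    adj G u m -> adj G u z -> adj G m z.
  move=> vu uc ul nvm nvz mv zv mz um uz; apply/negPn/negP => nmz; case: nS.
  have nuc := nN u c vu vc uc ul; have nul := nN u l vu vl uc ul.
  relinking G [:: (c, l); (u, m); (u, z)] [:: (l, u); (m, z); (u, c)] H dH new keep fx.
  case/and4P: new => lu _ uc' _; apply: (settled_eq dH).
  have vH : adj H v =1 adj G v by apply: fx; graph.
  by apply: (@cherry_settled H v u l c) => //;
    [exact: apex_eq aG | rewrite ?vH //; graph ..].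
have [u] := @card_extra _ [:: c; l] (ltnW (apex_rich aG)).
rewrite !inE negb_or => /andP[vu du] /andP[uc ul].
have [u' ] := @card_extra _ [:: c; l; u] (apex_rich aG).
rewrite !inE !negb_or => /andP[vu' du'] /and3P[u'c u'l u'u].
have farU w m : adj G v w -> w != c -> w != l -> m \in nbhd G w :\ v ->
    [/\ m != v, ~~ adj G v m & adj G w m].
  move=> vw wc wl; rewrite !inE => /andP[mv wm]; split=> //.
  by apply: contraL wm => vm; exact: nN.
pose A := nbhd G u :\ v; pose B := nbhd G u' :\ v.
have farA m : m \in A -> [/\ m != v, ~~ adj G v m & adj G u m] by exact: farU.
have farB m : m \in B -> [/\ m != v, ~~ adj G v m & adj G u' m] by exact: farU.
have dA : degree G u = #|A|.+1.
  by rewrite degree_nbhd (cardsD1 v) inE adj_sym vu.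
have dB : degree G u' = #|B|.+1.
  by rewrite degree_nbhd (cardsD1 v) inE adj_sym vu'.
have spread m : m \in A -> (A :|: B) :\ m \subset nbhd G m.
  move=> mA; have [mv nvm um] := farA m mA.
  apply/subsetP => z; rewrite in_setD1 in_setU => /andP[zm /orP[zA|zB]].
    have [zv nvz uz] := farA z zA; rewrite inE.
    by apply: (cliqueU u m z) => //; graph.
  have [zv nvz uz] := farB z zB; rewrite inE.
  by apply: (clique u u' m z) => //; graph.
have notAB w : adj G v w -> w \notin A :|: B.
  move=> vw; rewrite in_setU; apply/negP.
  by case/orP=> [/farA|/farB] [_ nvw _]; clash.
have cardD m : m \in A -> #|u |: (A :|: B) :\ m| = #|A :|: B|.
  move=> mA; rewrite cardsU1 in_setD1 negb_and notAB // orbT.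
  by rewrite [RHS](cardsD1 m) in_setU mA.
(* So a vertex of [A] has degree at least the size of [A :|: B], while domination allows at most |A|
   + 1 and |B| + 1. *)
have subD m : m \in A -> u |: (A :|: B) :\ m \subset nbhd G m.
  move=> mA; rewrite subUset spread // andbT sub1set inE.
  by have [_ _ um] := farA m mA; rewrite adj_sym.
(* Both cases A = B and A, B disjoint establish the hypothesis of frame: only u
   and u' can have neighbours outside the closed neighbourhood of v. *)
have frame : (forall w m, adj G v w -> w != u -> w != u' -> ~~ adj G v m -> m != v ->
      ~~ adj G w m) ->
    [/\ nbhd G c = [set v; l], nbhd G l = [set v; c],
        forall m, ~~ adj G v m -> m != v -> degree G m <= 2 &
        forall w m, adj G v w -> 1 < degree G m -> ~~ adj G v m -> m != v ->
          w \in [:: c; l; u; u']].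
  move=> closed.
  have nbc : nbhd G c = [set v; l].
    apply/setP => z; rewrite !inE; have [->|zv] := eqVneq z v; first by rewrite cv.
    have [->|zl] := eqVneq z l; first by rewrite cl.
    apply/negP => cz; case: (boolP (adj G v z)) => vz.
      by have zc : z != c; [graph | have := nN z c vz vc zc zl; rewrite adj_sym cz].
    by move: cz; apply/negP; apply: closed => //; graph.
  have nbl : nbhd G l = [set v; c].
    apply/setP => z; rewrite !inE; have [->|zv] := eqVneq z v; first by rewrite lv.
    have [->|zc] := eqVneq z c; first by rewrite lc.
    apply/negP => lz; case: (boolP (adj G v z)) => vz.
      by have zl : z != l; [graph | have := nN z l vz vl zc zl; rewrite adj_sym lz].
    by move: lz; apply/negP; apply: closed => //; graph.
  split=> // [m nvm mv|w m vw dm nvm mv].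
    apply: leq_trans (apex_dom aG vc nvm mv) _.
    by rewrite degree_nbhd nbc cards2; case: (_ != _).
  apply: contraT; rewrite !inE !negb_or => /and4P[wc wl wu wu'].
  have [z wz zv] := @second_nbr G w v (leq_trans dm (apex_dom aG vw nvm mv)).
  case: (boolP (adj G v z)) => vz; first by have := nN w z vw vz wc wl; rewrite wz.
  by case/negP: (closed w z vw wu wu' vz zv).
have escape : (forall w m, adj G v w -> w != u -> w != u' -> ~~ adj G v m -> m != v ->
      ~~ adj G w m) -> forall y, ~~ adj G v y -> y != v -> y \notin A :|: B ->
    exists z, [/\ z != v, ~~ adj G v z & adj G y z].
  move=> closed y nvy yv; rewrite !inE negb_or yv /= => /andP[nuy nu'y].
  have [z] := @card_extra (nbhd G y) [::] (apex_pos aG y); rewrite inE => yz _.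
  exists z; split=> //; first by graph.
  apply/negP => vz; have zy : adj G z y by rewrite adj_sym.
  have zu : z != u by graph.
  have zu' : z != u' by graph.
  by have := closed z y vz zu zu' nvy yv; rewrite zy.
have twice x a b : nbhd G x = [set a; b] -> a != b -> degree G x = 2.
  by move=> nb ab; rewrite degree_nbhd nb cards2 ab.
have dv4 : (forall w, adj G v w -> w \in [:: c; l; u; u']) -> degree G v = 4.
  move=> only; rewrite degree_nbhd (_ : nbhd G v = [set x in [:: c; l; u; u']]).
    by rewrite cardsE; apply/card_uniqP; graph.
  apply/setP => z; rewrite !inE; apply/idP/idP => [/only|]; first by rewrite !inE.
  by case/or4P=> /eqP->.
(* A common outside neighbour sees [u'] as well as [u], so it reaches degree |A ∪ B| + 1, which
   forces [A = B]. *)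
case: (boolP [exists m, (m \in A) && (m \in B)]).
  case/existsP => m /andP[mA mB].
  have AB_eq : A :|: B = A /\ A :|: B = B.
    have [mv nvm um] := farA m mA; have [_ _ u'm] := farB m mB.
    have : #|u' |: (u |: (A :|: B) :\ m)| <= degree G m.
      apply/subset_leq_card; rewrite subUset subD // andbT sub1set inE.
      by rewrite adj_sym.
    rewrite cardsU1 cardD // in_setU1 in_setD1 !negb_or negb_and notAB // orbT u'u /=.
    have := apex_dom aG vu nvm mv; have := apex_dom aG vu' nvm mv; rewrite dA dB.
    move=> leB leA le.
    have leA' : #|A :|: B| <= #|A| by move: le leA; clear; lia.
    have leB' : #|A :|: B| <= #|B| by move: le leB; clear; lia.
    split; apply/esym/eqP; rewrite eqEcard; apply/andP; split=> //.
      exact: subsetUl.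
    exact: subsetUr.
  have AB : A = B by rewrite -[RHS]AB_eq.2 AB_eq.1.
  have nbm z : z \in A -> nbhd G z = u' |: (u |: A :\ z).
    move=> zA; have zB : z \in B by rewrite -AB.
    have [zv nvz uz] := farA z zA; have [_ _ u'z] := farB z zB.
    apply/esym/eqP; rewrite eqEcard; apply/andP; split.
      rewrite -AB_eq.1 subUset subD // andbT sub1set inE.
      by rewrite adj_sym.
    rewrite cardsU1 -AB_eq.1 cardD // in_setU1 in_setD1 !negb_or negb_and notAB // orbT u'u /=.
    by have := apex_dom aG vu nvz zv; rewrite dA AB_eq.1 add1n.
  have [mv nvm um] := farA m mA; have [_ _ u'm] := farB m mB.
  have closed w z : adj G v w -> w != u -> w != u' -> ~~ adj G v z -> z != v -> ~~ adj G w z.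
    move=> vw wu wu' nvz zv; apply/negP => wz.
    have zA : z \in A.
      have [->//|zm] := eqVneq z m.
      have : z \in nbhd G m by rewrite inE; apply: (clique u w m z) => //; graph.
      by rewrite nbm // !inE (negPf zm) => /or3P[/eqP E|/eqP E|] //; subst; clash.
    have : w \in nbhd G z by rewrite inE adj_sym.
    rewrite nbm // !in_setU1 (negPf wu) (negPf wu') in_setD1 => /andP[_ wA].
    by have [_ nvw _] := farA w wA; clash.
  have [nbc nbl dM onlyN] := frame closed.
  have mu : adj G m u by rewrite adj_sym.
  have mu' : adj G m u' by rewrite adj_sym.
  have uu' : u != u' by rewrite eq_sym.
  have dm : degree G m = 2.
    apply/eqP; rewrite eqn_leq dM //=.
    by apply: (@degree_ge G m [:: u; u']); rewrite /= ?inE; graph.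
  have A1 : A = [set m].
    apply/eqP; rewrite eqEsubset sub1set mA andbT; apply/subsetP => z zA.
    rewrite inE; apply: contraT => zm; have [zv nvz uz] := farA z zA.
    have mz : adj G m z.
      have : z \in nbhd G m; last by rewrite inE.
      by rewrite nbm // !in_setU1 in_setD1 zm zA !orbT.
    by case: (degree2_nbrs mu mu' uu' (dM m nvm mv) mz) => E; subst; clash.
  have only_vw w : adj G v w -> w \in [:: c; l; u; u'].
    by move=> vw; apply: (onlyN w m); rewrite ?dm.
  have only_m y : ~~ adj G v y -> y != v -> y = m.
    move=> nvy yv; apply/eqP; apply: contraT => ym.
    have [|z [zv nvz yz]] := escape closed y nvy yv.
      by rewrite -AB setUid A1 inE.
    have nbm2 x : adj G m x -> x = u \/ x = u'.
      by apply: degree2_nbrs => //; exact: dM.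
    have nmy : ~~ adj G m y by apply/negP => /nbm2[] E; subst; clash.
    have nmz : ~~ adj G m z by apply/negP => /nbm2[] E; subst; clash.
    have zm : z != m by graph.
    have ncu : ~~ adj G c u by rewrite adj_sym; apply: nN.
    have nlu' : ~~ adj G l u' by rewrite adj_sym; apply: nN.
    (* The edge [c l] is replaced by the disjoint edges [c u] and [l u'], while [m] exchanges [u],
       [u'] for [y], [z]. *)
    case: nS; relinking G [:: (c, l); (u, m); (u', m); (y, z)]
      [:: (c, u); (l, u'); (m, y); (m, z)] H dH new keep fx.
    case/and5P: new => cu' lu' _ _ _; apply: (settled_eq dH).
    have vH : adj H v =1 adj G v by apply: fx; graph.
    by apply: (@bowtie_settled H v c u l u') => //; rewrite ?vH //; graph.
  have enumT : perm_eq (enum T) [:: v; c; l; u; u'; m].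
    apply: enum_perm; first by graph.
    move=> y; rewrite !inE; have [//|yv] := eqVneq y v.
    case: (boolP (adj G v y)) => vy; last by rewrite (only_m y) ?eqxx ?orbT.
    by move: (only_vw y vy); rewrite !inE => /or4P[]->; rewrite ?orbT.
  case: nS; right; constructor 3; rewrite cardT (perm_size enumT); split=> //.
  apply: (perm_trans (perm_map _ enumT)); rewrite /= (dv4 only_vw) dm dA dB -AB A1 cards1.
  rewrite (twice c v l) // ?(twice l v c) //; first by graph.
  by graph.
rewrite negb_exists => /forallP AIB.
have cardAB : #|A :|: B| = #|A| + #|B|.
  rewrite cardsU (_ : A :&: B = set0) ?cards0 ?subn0 //.
  by apply/setP => z; rewrite in_setI in_set0; apply/negbTE.
have [m1 m1A] : exists m, m \in A by apply/card_gt0P; rewrite -ltnS -dA.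
have [m2 m2B] : exists m, m \in B by apply/card_gt0P; rewrite -ltnS -dB.
have [m1v nvm1 um1] := farA m1 m1A; have [m2v nvm2 um2] := farB m2 m2B.
(* By disjointness |A| + |B| is at most the degree of [m1], hence at most |A| + 1 and |B| + 1. *)
have [A1 B1] : #|A| = 1 /\ #|B| = 1.
  have := subset_leq_card (subD m1 m1A); rewrite cardD // cardAB -degree_nbhd.
  have := apex_dom aG vu nvm1 m1v; have := apex_dom aG vu' nvm1 m1v.
  have : 0 < #|A| by apply/card_gt0P; exists m1.
  have : 0 < #|B| by apply/card_gt0P; exists m2.
  by rewrite dA dB; clear; lia.
have {}A1 : A = [set m1] by move/eqP/cards1P: A1 m1A => [x ->]; rewrite inE => /eqP->.
have {}B1 : B = [set m2] by move/eqP/cards1P: B1 m2B => [x ->]; rewrite inE => /eqP->.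
have m12 : m1 != m2.
  by apply/eqP => E; have := AIB m1; rewrite m1A E m2B.
have m1m2 : adj G m1 m2 by apply: (clique u u' m1 m2) => //; graph.
have nbm1 z : adj G m1 z -> z = u \/ z = m2.
  apply: degree2_nbrs => //; try by graph.
  by have := apex_dom aG vu nvm1 m1v; rewrite dA A1 cards1.
have nbm2 z : adj G m2 z -> z = u' \/ z = m1.
  apply: degree2_nbrs => //; try by graph.
  by have := apex_dom aG vu' nvm2 m2v; rewrite dB B1 cards1.
have closed w z : adj G v w -> w != u -> w != u' -> ~~ adj G v z -> z != v -> ~~ adj G w z.
  move=> vw wu wu' nvz zv; apply/negP => wz.
  have zm1 : z != m1.
    by apply/eqP => E; subst z; case: (nbm1 w); [graph | move=> E; subst; clash ..].
  have zm2 : z != m2.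
    by apply/eqP => E; subst z; case: (nbm2 w); [graph | move=> E; subst; clash ..].
  have : adj G m1 z by apply: (clique u w m1 z) => //; graph.
  by case/nbm1 => E; subst; clash.
have [nbc nbl dM onlyN] := frame closed.
have dm1 : degree G m1 = 2.
  apply/eqP; rewrite eqn_leq dM //=.
  by apply: (@degree_ge G m1 [:: u; m2]); rewrite /= ?inE; graph.
have dm2 : degree G m2 = 2.
  apply/eqP; rewrite eqn_leq dM //=.
  by apply: (@degree_ge G m2 [:: u'; m1]); rewrite /= ?inE; graph.
have only_vw w : adj G v w -> w \in [:: c; l; u; u'].
  by move=> vw; apply: (onlyN w m1); rewrite ?dm1.
have only_m y : ~~ adj G v y -> y != v -> y \in [:: m1; m2].
  move=> nvy yv; apply: contraT; rewrite !inE negb_or => /andP[ym1 ym2].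
  have [|z [zv nvz yz]] := escape closed y nvy yv.
    by rewrite A1 B1 !inE negb_or ym1.
  have nm1y : ~~ adj G m1 y by apply/negP => /nbm1[] E; subst; clash.
  have nm2y : ~~ adj G m2 y by apply/negP => /nbm2[] E; subst; clash.
  have zm1 : z != m1 by graph.
  have zm2 : z != m2 by graph.
  have nm2z : ~~ adj G m2 z by apply/negP => /nbm2[] E; subst; clash.
  have nuu' : ~~ adj G u u' by apply: nN.
  (* Breaking [y z] lets [m1] and [m2] release [u] and [u']; the new edge [u u'] is disjoint from
     [c l]. *)
  case: nS; relinking G [:: (u, m1); (u', m2); (y, z)]
    [:: (u, u'); (m1, y); (m2, z)] H dH new keep fx.
  case/and4P: new => uu' _ _ _; apply: (settled_eq dH).
  have vH : adj H v =1 adj G v by apply: fx; graph.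
  by apply: (@bowtie_settled H v c l u u') => //; rewrite ?vH ?keep //; graph.
have enumT : perm_eq (enum T) [:: v; c; l; u; u'; m1; m2].
  apply: enum_perm; first by graph.
  move=> y; rewrite !inE; have [//|yv] := eqVneq y v.
  case: (boolP (adj G v y)) => vy.
    by move: (only_vw y vy); rewrite !inE => /or4P[]->; rewrite ?orbT.
  by move: (only_m y vy yv); rewrite !inE => /orP[]->; rewrite ?orbT.
case: nS; right; constructor 4; rewrite cardT (perm_size enumT); split=> //.
apply: (perm_trans (perm_map _ enumT)); rewrite /= (dv4 only_vw) dm1 dm2 dA dB A1 B1 !cards1.
rewrite (twice c v l) // ?(twice l v c) //; first by graph.
by graph.
Qed.

(** * Independent neighbourhoods *)

Lemma apex_settled G v : apex G v -> settled G.
Proof.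
move=> aG; apply: NNPP => nS.
have nN c l : adj G v c -> adj G v l -> ~~ adj G c l.
  by move=> vc vl; apply/negP => cl; case: nS; exact: (@edge_settled G v c l).
have clique w1 w2 m1 m2 : adj G v w1 -> adj G v w2 -> w1 != w2 ->
    ~~ adj G v m1 -> ~~ adj G v m2 -> m1 != v -> m2 != v ->
    m1 != m2 -> adj G w1 m1 -> adj G w2 m2 -> adj G m1 m2.
  move=> vw1 vw2 w12 nvm1 nvm2 m1v m2v m12 wm1 wm2.
  apply/negPn/negP => nm12; case: nS; have nw12 := nN _ _ vw1 vw2.
  relinking G [:: (w1, m1); (w2, m2)] [:: (w1, w2); (m1, m2)] H dH new keep fx.
  case/and3P: new => w12' _ _; apply: (settled_eq dH).
  have vH : adj H v =1 adj G v by apply: fx; graph.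
  by apply: (@edge_settled H v w1 w2) => //; [exact: apex_eq aG | rewrite ?vH ..].
pose F u := nbhd G u :\ v.
have farF u m : adj G v u -> m \in F u -> [/\ m != v, ~~ adj G v m & adj G u m].
  move=> vu; rewrite !inE => /andP[mv um]; split=> //.
  by apply: contraL um => vm; exact: nN.
have notF u w : adj G v u -> adj G v w -> w \notin F u.
  by move=> vu vw; apply/negP => /(farF u w vu)[_ nvw _]; clash.
have dF u : adj G v u -> degree G u = #|F u|.+1.
  by move=> vu; rewrite degree_nbhd (cardsD1 v) inE adj_sym vu.
(* The right side lies in the neighbourhood of [m] by [clique], and has |F w| + 1 elements, the most
   that domination by [w] allows. *)
have star u w m : adj G v u -> adj G v w -> u != w -> m \in F u ->
    nbhd G m = u |: (if m \in F w then w |: F w :\ m else F w).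
  move=> vu vw uw mFu; have [mv nvm um] := farF u m vu mFu.
  have sub : F w :\ m \subset nbhd G m.
    apply/subsetP => z; rewrite in_setD1 => /andP[zm /(farF w z vw)[zv nvz wz]].
    by rewrite inE; apply: (clique u w m z) => //; graph.
  apply/esym/eqP; rewrite eqEcard -[#|nbhd G m|]/(degree G m); apply/andP; split.
    rewrite subUset sub1set inE adj_sym um /=; case: ifP => [mFw|/negbT mFw].
      have [_ _ wm] := farF w m vw mFw.
      by rewrite subUset sub andbT sub1set inE adj_sym.
    apply: subset_trans sub; apply/subsetP => z zF; rewrite in_setD1 zF andbT.
    by apply: contraNneq mFw => <-.
  apply: leq_trans (apex_dom aG vw nvm mv) _; rewrite dF //.
  rewrite cardsU1; case: ifP => mFw; last by rewrite notF.
  rewrite in_setU1 (negPf uw) in_setD1 negb_and notF // orbT.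
  by rewrite cardsU1 in_setD1 negb_and notF // orbT (cardsD1 m (F w)) mFw.
(* Applying [star] through [w] would put [w] among the neighbours of [m]; applying it through [x]
   excludes [w]. *)
have apart u w x m : adj G v u -> adj G v w -> adj G v x ->
    u != w -> u != x -> w != x -> m \in F u -> m \notin F w.
  move=> vu vw vx uw ux wx mFu; apply/negP => mFw.
  have : w \in nbhd G m by rewrite (star u w) // mFw in_setU1 in_setU1 eqxx orbT.
  rewrite (star u x) // in_setU1 eq_sym (negPf uw) /=; case: ifP => _.
    by rewrite in_setU1 (negPf wx) in_setD1 (negPf (notF x w vx vw)) andbF.
  by rewrite (negPf (notF x w vx vw)).
have [u] := @card_extra _ [::] (leq_trans (isT : 0 < 4) (apex_rich aG)).
rewrite inE => /andP[vu du] _.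
have [w] := @card_extra _ [:: u] (leq_trans (isT : 1 < 4) (apex_rich aG)).
rewrite !inE => /andP[vw dw] wu.
have [x] := @card_extra _ [:: u; w] (leq_trans (isT : 2 < 4) (apex_rich aG)).
rewrite !inE negb_or => /andP[vx dx] /andP[xu xw].
have [m mFu] : exists m, m \in F u by apply/card_gt0P; rewrite -ltnS -dF.
have [z zFw] : exists z, z \in F w by apply/card_gt0P; rewrite -ltnS -dF.
have uw : u != w by graph.
have ux : u != x by graph.
have wx : w != x by graph.
(* The neighbourhood of [m] is [u |: F w] and also [u |: F x], yet [F w] is nonempty and disjoint
   from [F x]: no graph remains in this case. *)
have := star u w m vu vw uw mFu; rewrite (star u x m) //.
rewrite (negPf (apart u w x m _ _ _ _ _ _ _)) // (negPf (apart u x w m _ _ _ _ _ _ _)) //.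
  move=> E; have : z \in u |: F w by rewrite in_setU1 zFw orbT.
  rewrite -E in_setU1 (negPf (apart w x u z _ _ _ _ _ _ _)) //.
  by rewrite orbF => /eqP E'; subst z; have := notF w u vw vu; rewrite zFw.
Qed.

(** * Havel-Hakimi switches *)

Lemma dominant_neighbourhood G v :
  exists2 G', degree G' =1 degree G &
    forall u m, adj G' v u -> ~~ adj G' v m -> m != v -> degree G' m <= degree G' u.
Proof.
(* Each switch raises this sum, which is bounded by the total degree; the induction is on the
   gap. *)
pose weight G := \sum_(x in nbhd G v) degree G x.
suff main k H : degree H =1 degree G -> \sum_x degree G x - weight H < k ->
  exists2 G', degree G' =1 degree G &
    forall u m, adj G' v u -> ~~ adj G' v m -> m != v -> degree G' m <= degree G' u.
  by apply: main (ltnSn _).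
elim: k H => // k IH H dH lek.
case: (boolP [exists u, exists m, [&& adj H v u, ~~ adj H v m, m != v &
                                     degree H u < degree H m]]); last first.
  rewrite negb_exists => /forallP no; exists H => // u m vu nvm mv.
  have := no u; rewrite negb_exists => /forallP/(_ m).
  by rewrite vu nvm mv /= -leqNgt.
case/existsP=> u /existsP[m /and4P[vu nvm mv lt_um]].
(* Degrees are compared after deleting [u] and [v]: [u] surely has the neighbour [v], while [m] may
   or may not have the neighbour [u]. *)
have [w wm nwu] : exists2 w, w \in nbhd H m :\ u & w \notin nbhd H u :\ v.
  apply/subsetPn; apply: contraL lt_um => /subset_leq_card le.
  rewrite -leqNgt !degree_nbhd (cardsD1 u (nbhd H m)) (cardsD1 v (nbhd H u)).
  by rewrite [v \in _]inE adj_sym vu leq_add // leq_b1.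
move: wm; rewrite !inE => /andP[wu mw].
have wv : w != v by apply/eqP => E; subst w; clash.
move: nwu; rewrite !inE wv /= => nuw.
have um : u != m by graph.
relinking H [:: (v, u); (m, w)] [:: (v, m); (u, w)] H' dH' new keep fx.
case/and3P: new => vm _ _.
have sub : m |: (nbhd H v :\ u) \subset nbhd H' v.
  apply/subsetP => z; rewrite !inE => /orP[/eqP->//|/andP[zu vz]].
  by apply: keep => //; graph.
have lt : weight H < weight H'.
  have le : \sum_(x in m |: (nbhd H v :\ u)) degree H x <= weight H'.
    rewrite /weight [leqRHS](big_setID (m |: (nbhd H v :\ u))) /= (setIidPr sub).
    by apply: leq_trans (leq_addr _ _); apply/eq_leq/eq_bigr => x _; rewrite dH'.
  apply: leq_trans le; rewrite /weight big_setU1 ?inE ?(negPf nvm) ?andbF //=.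
  by rewrite (big_setD1 u) ?inE //= ltn_add2r.
have dH'G : degree H' =1 degree G by move=> x; rewrite dH'.
have ub : weight H' <= \sum_x degree G x.
  rewrite /weight [leqLHS]big_mkcond /=; apply: leq_sum => x _.
  by case: ifP => // _; rewrite dH'G.
by apply: (IH H') => //; move: lek lt ub; clear; lia.
Qed.

(** After the switches, a neighbour of [v] of degree 1 would confine all vertices of degree at least
    2 to N(v) + v, leaving four of them in N(v). Otherwise all neighbours of [v] qualify, and there
    are at least four. *)
Lemma settled_of_degrees G v :
    (forall x, 0 < degree G x) -> (forall x, degree G x <= degree G v) ->
    4 <= degree G v -> 5 <= #|[set x | 2 <= degree G x]| ->
  settled G.
Proof.
move=> pos max dv rich; have [H dH dom] := dominant_neighbourhood G v.
apply: (settled_eq dH); apply: (@apex_settled H v); split=> //.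
- by move=> x; rewrite dH.
- by move=> x; rewrite !dH.
case: (boolP [exists u, adj H v u && (degree H u <= 1)]) => [/existsP[u /andP[vu du]]|].
  have sub : [set x | 2 <= degree G x] \subset v |: [set u | adj H v u & 2 <= degree H u].
    apply/subsetP => x; rewrite !inE -dH => dx; rewrite dx andbT.
    have [//|xv] := eqVneq x v; apply: contraT => nvx.
    by have := leq_trans dx (leq_trans (dom u x vu nvx xv) du).
  have := leq_trans rich (subset_leq_card sub).
  by rewrite cardsU1; case: (v \notin _) => // /ltnW.
rewrite negb_exists => /forallP all2; rewrite -dH in dv.
apply: leq_trans dv _; apply/subset_leq_card/subsetP => x; rewrite !inE => vx.
by have := all2 x; rewrite vx /= -ltnNge.
Qed.

Lemma bowtie_of_contains G : contains G K5_minus_C4 ->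
  exists v a b c d, [/\ [&& adj G v a, adj G v b, adj G v c & adj G v d],
    adj G a b, adj G c d & uniq [:: v; a; b; c; d]].
Proof.
case=> f [f_inj fE].
pose o (k : nat) (lt : k < 5) := f (Ordinal lt).
exists (o 4 isT), (o 0 isT), (o 2 isT), (o 1 isT), (o 3 isT).
split; try by apply: fE.
  by apply/and4P; split; apply: fE.
rewrite -[X in uniq X]/(map f [:: @Ordinal 5 4 isT; @Ordinal 5 0 isT; @Ordinal 5 2 isT;
  @Ordinal 5 1 isT; @Ordinal 5 3 isT]).
by rewrite map_inj_uniq.
Qed.

(** * The excluded sequences *)

(* One of the two triangles at v misses y. *)
Lemma bowtie_two_big G : contains G K5_minus_C4 ->
  #|[set x | 3 <= degree G x]| = 2 ->
  exists v y a b, [/\ [set x | 3 <= degree G x] = [set v; y],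
    [/\ v != y, a != v, a != y & b != y], a != b /\ b != v, 2 <= degree G a &
    ~~ adj G y a /\ ~~ adj G y b].
Proof.
case/bowtie_of_contains=> v [a [b [c [d [/and4P[va vb vc vd] ab cd us]]]]] big2.
have v_big : v \in [set x | 3 <= degree G x].
  rewrite inE; apply: (@degree_ge G v [:: a; b; c]); last by rewrite /= va vb vc.
  by move: us => /= /and5P[_]; rewrite !inE !negb_or => /and3P[-> -> _] /andP[->].
have [y] : exists y, [set x | 3 <= degree G x] :\ v = [set y].
  by apply/cards1P; move: big2; rewrite (cardsD1 v) v_big add1n => -[->].
move=> big_y; have bigE : [set x | 3 <= degree G x] = [set v; y].
  by rewrite -(setD1K v_big) big_y.
have vy : v != y.
  by have := set11 y; rewrite -big_y in_setD1 eq_sym => /andP[].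
have small x : x != v -> x != y -> degree G x <= 2.
  move=> xv xy; rewrite leqNgt; apply/negP => dx.
  have : x \in [set x | 3 <= degree G x] by rewrite inE.
  by rewrite bigE !inE (negPf xv) (negPf xy).
(* In a triangle at [v] avoiding [y], the other two vertices have degree 2, so the triangle uses up
   their neighbours. *)
have main p q : adj G v p -> adj G v q -> adj G p q -> p != v -> q != v -> p != q ->
    p != y -> q != y -> exists v y a b, [/\ [set x | 3 <= degree G x] = [set v; y],
    [/\ v != y, a != v, a != y & b != y], a != b /\ b != v, 2 <= degree G a &
    ~~ adj G y a /\ ~~ adj G y b].
  move=> vp vq pq pv qv npq py qy; exists v, y, p, q; split=> //.
    by apply: (@degree_ge G p [:: v; q]); rewrite /= ?inE; graph.
  have pv' : adj G p v by rewrite adj_sym.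
  have qv' : adj G q v by rewrite adj_sym.
  have qp' : adj G q p by rewrite adj_sym.
  split; apply/negP; rewrite adj_sym => hy.
    have vq' : v != q by graph.
    by case: (degree2_nbrs pv' pq vq' (small p pv py) hy) => E; subst; clash.
  have vp' : v != p by graph.
  by case: (degree2_nbrs qv' qp' vp' (small q qv qy) hy) => E; subst; clash.
move: us => /= /and5P[]; rewrite !inE !negb_or.
move=> /and4P[nva nvb nvc nvd] /and3P[nab nac nad] /andP[nbc nbd] ncd _.
case: (boolP (y \in [:: a; b])) => hy.
  by move: hy; rewrite !inE => /orP[]/eqP E; subst y; apply: (main c d) => //; graph.
move: hy; rewrite !inE negb_or => /andP[hya hyb].
by apply: (main a b) => //; graph.
Qed.

Lemma count_degrees G (P : pred nat) :
  count P [seq degree G x | x : T] = #|[set x | P (degree G x)]|.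
Proof. by rewrite /image_mem count_map cardsE cardE -size_filter enumT. Qed.

(** The second large vertex misses itself and two triangle vertices, so its degree is at most n - 3
    instead of n - 2. *)
Lemma no_bowtie_double G n : #|T| = n -> 6 <= n ->
  perm_eq [seq degree G x | x : T] (nseq 2 (n - 2) ++ nseq (n - 2) 2) ->
  ~ contains G K5_minus_C4.
Proof.
move=> cT n6 /[dup] pE /permP/(_ (leq 3)); rewrite count_degrees count_cat !count_nseq => big2.
case/bowtie_two_big; first by rewrite big2; clear -n6; lia.
move=> v [y [a [b [bigE [vy av ay by_] [ab bv] da [nya nyb]]]]].
have dy : degree G y = n - 2.
  have : degree G y \in [seq degree G x | x : T] by apply: image_f.
  rewrite (perm_mem pE) mem_cat !mem_nseq => /orP[/andP[_ /eqP->//]|/andP[_ /eqP dy]].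
  have : y \in [set v; y] by rewrite !inE eqxx orbT.
  by rewrite -bigE inE dy.
have sub : nbhd G y \subset ~: [set x in [:: y; a; b]].
  apply/subsetP => x; rewrite !inE => yx; apply/negP.
  by case/or3P=> /eqP E; subst; clash.
have := subset_leq_card sub; rewrite -degree_nbhd [leqRHS]cardsCs setCK cardsE dy cT.
have /card_uniqP-> : uniq [:: y; a; b] by graph.
by move: n6; clear => /=; lia.
Qed.

(** The two large degrees add up to n + i, so [v] and [y] have at least i common neighbours.
    Together with [v], [y] and the triangle vertex [a] these are i + 3 vertices of degree at least
    2, but the sequence has only i + 2 such terms. *)
Lemma no_bowtie_family G n k i : #|T| = n ->
    1 <= k <= (n - 1) %/ 2 - 1 -> 3 <= i <= n - 2 * k ->
    perm_eq [seq degree G x | x : T]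
      ([:: n - k; k + i] ++ nseq i 2 ++ nseq (n - i - 2) 1) ->
  ~ contains G K5_minus_C4.
Proof.
move=> cT hk hi pE; have [nk3 ki3] : 2 < n - k /\ 2 < k + i by move: hk hi; clear; lia.
have pC (P : pred nat) : #|[set x | P (degree G x)]| =
    P (n - k) + (P (k + i) + (P 2 * i + P 1 * (n - i - 2))).
  by rewrite -count_degrees (permP pE) /= !count_cat !count_nseq.
case/bowtie_two_big; first by rewrite (pC (leq 3)) nk3 ki3.
move=> v [y [a [b [bigE [vy av ay by_] [ab bv] da [nya nyb]]]]].
have sum_vy : degree G v + degree G y = n + i.
  have <- : \sum_(x in [set v; y]) degree G x = degree G v + degree G y.
    by rewrite big_setU1 ?inE //= big_set1.
  rewrite -bigE (eq_bigl (fun x => 3 <= degree G x)); last by move=> x; rewrite inE.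
  have -> : \sum_(x | 3 <= degree G x) degree G x =
      \sum_(d <- [seq degree G x | x : T] | 3 <= d) d.
    by rewrite /image_mem big_map big_enum_cond.
  rewrite (perm_big _ pE) /= !big_cons nk3 ki3 big_cat !big_nseq_cond /= !addn0.
  by move: hk hi; clear; lia.
have := cardsUI (nbhd G v) (nbhd G y); rewrite -!degree_nbhd sum_vy.
have := max_card (nbhd G v :|: nbhd G y); rewrite cT.
have : #|a |: (v |: (y |: (nbhd G v :&: nbhd G y)))| <= #|[set x | 2 <= degree G x]|.
  apply/subset_leq_card/subsetP => x; rewrite !inE.
  have big3 z : z \in [set v; y] -> 2 <= degree G z.
    by rewrite -bigE inE => /ltnW.
  case/or4P=> [/eqP->|/eqP->|/eqP->|/andP[vx yx]] //; try by apply: big3; rewrite !inE eqxx ?orbT.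
  by apply: (@degree_ge G x [:: v; y]); rewrite /= ?inE; graph.
rewrite (pC (leq 2)) (ltnW nk3) (ltnW ki3) !cardsU1 !inE !negb_or.
rewrite (negPf nya) !adj_irrefl !andbF av ay vy /=.
by clear; lia.
Qed.

(** The bowtie saturates all five of its vertices, so a further vertex has neighbours only among the
    at most one other vertex left, against degree 2. *)
Lemma no_bowtie_small G m : #|T| = m.+1 -> 5 <= m <= 6 ->
    perm_eq [seq degree G x | x : T] (4 :: nseq m 2) ->
  ~ contains G K5_minus_C4.
Proof.
move=> cT hm pE /bowtie_of_contains[v [a [b [c [d [/and4P[va vb vc vd] ab cd us]]]]]].
have deg x : degree G x = 4 \/ degree G x = 2.
  have : degree G x \in [seq degree G x | x : T] by apply: image_f.
  by rewrite (perm_mem pE) inE mem_nseq => /orP[/eqP|/andP[_ /eqP]]; [left|right].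
move: (us) => /= /and5P[]; rewrite !inE !negb_or.
move=> /and4P[nva nvb nvc nvd] /and3P[nab nac nad] /andP[nbc nbd] ncd _.
have dv : 4 <= degree G v.
  by apply: (@degree_ge G v [:: a; b; c; d]); rewrite /= ?inE; graph.
have small x : x != v -> degree G x <= 2.
  move=> xv; case: (deg x) => [dx|->//].
  have : #|[set x | 3 <= degree G x]| = 1.
    by rewrite -count_degrees (permP pE) /= count_nseq.
  case/eqP/cards1P=> z /setP zE.
  have /esym := zE x; have /esym := zE v; rewrite !inE dx (ltnW dv) => /eqP vz /eqP xz.
  by case/eqP: xv; rewrite xz.
have tri p q z : adj G v p -> adj G v q -> adj G p q -> p != v -> adj G p z ->
    z = v \/ z = q.
  move=> vp vq pq pv; apply: degree2_nbrs => //; [by rewrite adj_sym|by graph|exact: small].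
have [w _] : exists2 w, w \in [set: T] & w \notin [:: v; a; b; c; d].
  by apply: card_extra; rewrite cardsT cT; case/andP: hm.
rewrite !inE !negb_or => /and5P[wv wa wb wc wd].
have ba : adj G b a by rewrite adj_sym.
have dc : adj G d c by rewrite adj_sym.
have far p q : adj G v p -> adj G v q -> adj G p q -> p != v -> w != q -> ~~ adj G w p.
  move=> vp vq pq pv wq; rewrite adj_sym; apply/negP.
  by case/(tri p q w vp vq pq pv) => E; subst; clash.
have nwa : ~~ adj G w a by apply: (far a b) => //; graph.
have nwb : ~~ adj G w b by apply: (far b a) => //; graph.
have nwc : ~~ adj G w c by apply: (far c d) => //; graph.
have nwd : ~~ adj G w d by apply: (far d c) => //; graph.
have nwv : ~~ adj G w v.
  rewrite adj_sym; apply/negP => vw.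
  have : 5 <= degree G v.
    by apply: (@degree_ge G v [:: a; b; c; d; w]); rewrite /= ?inE; graph.
  by case: (deg v) => ->.
have sub : nbhd G w \subset ~: [set x in [:: w; v; a; b; c; d]].
  apply/subsetP => x; rewrite !inE => wx; apply/negP.
  by case/or4P=> [/eqP E|/eqP E|/eqP E|/or3P[]/eqP E]; subst; clash.
have := subset_leq_card sub; rewrite -degree_nbhd [leqRHS]cardsCs setCK cardsE cT.
have /card_uniqP-> : uniq [:: w; v; a; b; c; d].
  by rewrite cons_uniq us andbT !inE !negb_or; graph.
move=> dw; have : 2 <= degree G w by case: (deg w) => ->.
by move: dw hm; clear => /=; lia.
Qed.

End Bowtie.

(** * Sorted sequences and the equivalence *)

Lemma nth_geq_count (s : seq nat) t k :
  sorted geq s -> 0 < t -> (t <= nth 0 s k) = (k < count (leq t) s).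
Proof.
(* Positivity of [t] matters because [nth] returns 0 past the end. *)
move=> + t0; elim: s k => [|x s IH] k; first by rewrite nth_nil leqNgt t0.
rewrite /= (path_sortedE (rev_trans leq_trans)) => /andP[/allP sx ss].
case: (leqP t x) => tx; first by case: k => [|k] /=; rewrite ?tx ?IH.
have -> : count (leq t) s = 0.
  apply/eqP; rewrite -leqn0 leqNgt -has_count; apply/hasPn => y /sx yx.
  by rewrite -ltnNge (leq_ltn_trans yx).
case: k => [|k] /=; first by rewrite leqNgt tx.
apply/negbTE; rewrite -ltnNge; case: (ltnP k (size s)) => ks.
  by apply: leq_ltn_trans tx; apply/sx/mem_nth.
by rewrite nth_default.
Qed.

Lemma path_geq_nseq m x y (s : seq nat) :
  y <= x -> path geq y s -> path geq x (nseq m y ++ s).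
Proof.
elim: m x => [|m IH] x yx ys /=; last by rewrite yx IH.
by case: s ys => //= z s /andP[zy ->]; rewrite andbT (leq_trans zy).
Qed.

Lemma eq_of_perm_sorted_geq (s t : seq nat) :
  perm_eq s t -> sorted geq s -> sorted geq t -> s = t.
Proof.
move=> st ss ts; apply: (sorted_eq _ _ ss ts st); first exact: (rev_trans leq_trans).
by move=> x y; rewrite andbC => /anti_leq.
Qed.

(* The term d_i of the sequence is nth 0 pi (i - 1). *)
Theorem theorem3p1 (n : nat) (pi : n.-tuple nat)
    (hn : 5 <= n)
    (hpi_noninc : sorted geq pi)
    (hpi_pos : forall d : nat, d \in pi -> 0 < d)
    (hpi_graphic : graphic pi) :
  potentially K5_minus_C4 pi <->
    [/\ nth 0 pi 0 >= 4,
        nth 0 pi 4 >= 2,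
        (n >= 6 -> (pi : seq nat) <> nseq 2 (n - 2) ++ nseq (n - 2) 2),
        (forall k i : nat,
           1 <= k <= (n - 1) %/ 2 - 1 ->
           3 <= i <= n - 2 * k ->
           (pi : seq nat) <>
             [:: n - k; k + i] ++ nseq i 2 ++ nseq (n - i - 2) 1)
      & (n = 6 -> (pi : seq nat) <> 4 :: nseq 5 2) /\
        (n = 7 -> (pi : seq nat) <> 4 :: nseq 6 2)].
Proof.
have cardn : #|'I_n| = n by exact: card_ord.
have degs (G : sgraph 'I_n) (P : pred nat) : realization G pi ->
    count P pi = #|[set x | P (degree G x)]|.
  by rewrite -count_degrees => /permP->.
split=> [[G [Gpi cG]]|[pi0 pi4 ndouble nfamily [nsmall6 nsmall7]]].
  have [v [a [b [c [d [/and4P[va vb vc vd] ab cd us]]]]]] := bowtie_of_contains cG.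
  have dv : 4 <= degree G v.
    apply: (@degree_ge _ G v [:: a; b; c; d]); first by case/andP: us.
    by rewrite /= va vb vc vd.
  have sym x y : adj G x y -> adj G y x by rewrite adj_sym.
  have uvx x : adj G v x -> v != x by apply: contraTneq => <-; rewrite adj_irrefl.
  split.
  (* Conditions on positions become counts of large terms, which any listing of the degrees
     determines. *)
  - rewrite nth_geq_count // (degs G) //; apply/card_gt0P; exists v.
    by rewrite inE.
  - rewrite nth_geq_count // (degs G) //.
    rewrite -[4.+1]/(size [:: v; a; b; c; d]) -(card_uniqP us).
    have two x y : adj G v x -> adj G x y -> v != y -> 2 <= degree G x.
      move=> vx xy vy; apply: (@degree_ge _ G x [:: v; y]); first by rewrite /= inE vy.
      by rewrite /= xy sym.
    apply/subset_leq_card/subsetP => x; rewrite [x \in _ -> _]/= !inE.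
    case/or4P=> [/eqP->|/eqP->|/eqP->|/orP[]/eqP->].
    + exact: leq_trans dv.
    + exact: (two a b va ab (uvx _ vb)).
    + exact: (two b a vb (sym _ _ ab) (uvx _ va)).
    + exact: (two c d vc cd (uvx _ vd)).
    + exact: (two d c vd (sym _ _ cd) (uvx _ vc)).
  - move=> n6 E; rewrite /realization E in Gpi.
    exact: (no_bowtie_double cardn n6 Gpi).
  - move=> k i hk hi E; rewrite /realization E in Gpi.
    exact: (no_bowtie_family cardn hk hi Gpi).
  by split=> n_eq E; rewrite /realization E in Gpi;
     apply: (no_bowtie_small _ _ Gpi cG); rewrite ?cardn.
case: hpi_graphic => G Gpi.
have [v0 dv0] : exists v0, v0 \in [set x | 4 <= degree G x].
  by apply/card_gt0P; rewrite -(degs G) // -nth_geq_count.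
have pos x : 0 < degree G x.
  by apply: hpi_pos; rewrite -(perm_mem Gpi); apply: image_f.
have [v max_v] : exists v, forall x, degree G x <= degree G v.
  by case: (@arg_maxnP _ v0 predT (degree G) isT) => v _ max; exists v => x; apply: max.
have dv : 4 <= degree G v by move: dv0; rewrite inE => /leq_trans; apply.
have rich : 5 <= #|[set x | 2 <= degree G x]| by rewrite -(degs G) // -nth_geq_count.
case: (settled_of_degrees pos max_v dv rich) => [[H [dH cH]]|].
  exists H; split=> //; rewrite /realization /image_mem (eq_map dH).
  exact: Gpi.
rewrite cardn => exc; exfalso.
(* Nonincreasing lists that are permutations of each other coincide, so exceptional degrees mean an
   excluded sequence. *)
have eq_pi s : perm_eq [seq degree G x | x : 'I_n] s -> sorted geq s -> pi = s :> seq nat.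
  by rewrite (permPl Gpi) => pis ss; apply: eq_of_perm_sorted_geq.
case: exc => [[n6 /eq_pi E]|[k [i [hk hi /eq_pi E]]]|[n6 /eq_pi E]|[n7 /eq_pi E]].
- apply: ndouble => //; apply: E; rewrite -[_ ++ _]/([:: n - 2, n - 2 & _]) /= leqnn.
  by rewrite -[nseq (n - 2) 2]cats0 path_geq_nseq //; clear -n6; lia.
- apply: (nfamily k i) => //; apply: E; rewrite /= -[nseq (n - i - 2) 1]cats0.
  (* The bound i <= n - 2k gives k + i <= n - k, so the first two terms are in order. *)
  apply/andP; split; first by move: hk hi; clear; rewrite /geq /=; lia.
  apply: path_geq_nseq; first by move: hk hi; clear; lia.
  exact: path_geq_nseq.
- by apply: nsmall6 => //; apply: E.
by apply: nsmall7 => //; apply: E.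
Qed.
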